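(* Suppose that there exists a finite projective plane $\Pi_q$ of order $q>3$. Then there exists a bipartite $$egr\bigl(2(q^2-q),\, q-1,\, 6,\, (q-2)(q-3)^2\bigr).$$
   Context: All graphs are simple, finite and connected. A $(k,g)$-graph is a $k$-regular graph of girth $g$. An edge-girth-regular graph $egr(n,k,g,\lambda)$ is a $(k,g)$-graph on $n$ vertices in which every edge is contained in exactly $\lambda$ distinct cycles of length $g$. *)

(* Defs.v *)
From mathcomp Require Import all_boot.

Set Implicit Arguments.
Unset Strict Implicit.
Unset Printing Implicit Defensive.

Record projective_plane := ProjectivePlane {
  point : finType;
  line : finType;
  incident : point -> line -> bool;
  join_unique : forall x y : point, x != y ->
    exists! l : line, incident x l && incident y l;
  meet_unique : forall l m : line, l != m ->
    exists! x : point, incident x l && incident x m;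
  (* non-degeneracy: four points, no three of which are collinear *)
  quadrangle : exists Q : {set point},
    #|Q| = 4 /\ forall l : line, #|[set x in Q | incident x l]| <= 2
}.

Definition plane_order (Pi : projective_plane) (q : nat) : Prop :=
  forall l : line Pi, #|[set x : point Pi | incident x l]| = q.+1.

Record sgraph := SGraph {
  vertex :> finType;
  adj : rel vertex;
  adj_sym : symmetric adj;
  adj_irrefl : irreflexive adj
}.

Definition connected_graph (G : sgraph) : Prop :=
  0 < #|G| /\ forall x y : G, connect (@adj G) x y.

Definition bipartite (G : sgraph) : Prop :=
  exists A : {set G}, forall x y : G, adj x y -> (x \in A) != (y \in A).

Definition regular (G : sgraph) (k : nat) : Prop :=
  forall x : G, #|[set y : G | adj x y]| = k.

Definition cycle_edges (T : finType) (c : seq T) : {set {set T}} :=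
  [set [set x; next c x] | x in c].

(* A cycle is identified with its edge set, so rotations and the reversal of
   a closed vertex sequence give one and the same cycle. Lengths below 3 are
   excluded because [ucycleb] also accepts the sequences [::] and, when x and
   y are adjacent, [:: x; y]. *)
Definition cycles (G : sgraph) (g : nat) : {set {set {set G}}} :=
  [set cycle_edges (val c) | c : g.-tuple G & (2 < g) && ucycleb (@adj G) c].

Definition has_girth (G : sgraph) (g : nat) : Prop :=
  cycles G g != set0 /\ forall m : nat, m < g -> cycles G m = set0.

Definition kg_graph (G : sgraph) (k g : nat) : Prop :=
  [/\ connected_graph G, regular G k & has_girth G g].

Definition egr (G : sgraph) (n k g lambda : nat) : Prop :=
  [/\ kg_graph G k g,
      #|G| = n
    & forall x y : G, adj x y ->
        #|[set C in cycles G g | [set x; y] \in C]| = lambda].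

(* Main.v *)
Require Import Defs.
From mathcomp Require Import all_boot.
From mathcomp Require Import zify.

(* Choose a line l1, points p1, p2 on it and a second line l2 through p1.
   Delete the points of l1 and l2 and the lines through p1 or p2; the Levi
   graph of what remains is the required graph, and the choice is self-dual.
   Hexagons are triangles of the geometry. Given a kept flag (p, l) and one of
   the q - 2 other kept points p' of l, let m run over the q - 2 kept lines
   other than l through p. The third vertex is a kept point of m other than p
   and off the lines p'p1 and p'p2. These two lines meet m in distinct points,
   both kept unless m passes through the common point w of p'p2 and l2, which
   happens for exactly one m. So there are
   (q - 2)(q - 4) + 1 = (q - 3)^2 triangles for each p'. *)

Set Implicit Arguments.
Unset Strict Implicit.
Unset Printing Implicit Defensive.

(** * Cycles as edge sets and as closed vertex sequences *)

Lemma set2_inj_cases (T : finType) (a b x y : T) :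
  [set a; b] = [set x; y] -> (a = x /\ b = y) \/ (a = y /\ b = x).
Proof.
move/setP=> e.
have := e a; have := e b; have := e x; have := e y.
rewrite !inE !eqxx !orbT /=.
move=> /orP[/eqP ya|/eqP yb] /orP[/eqP xa|/eqP xb] hb ha; auto.
- by move: hb; rewrite xa ya orbb => /esym/eqP ->; left.
- by move: ha; rewrite xb yb orbb => /esym/eqP ->; left.
Qed.

Lemma cycle_edges_rot (T : finType) n (c : seq T) :
  uniq c -> cycle_edges (rot n c) = cycle_edges c.
Proof.
move=> Uc; apply/setP=> e; apply/imsetP/imsetP=> [] [u uc ->]; exists u => //.
- by move: uc; rewrite mem_rot.
- by rewrite next_rot.
- by rewrite mem_rot.
- by rewrite next_rot.
Qed.

Lemma cycle_edges_rev (T : finType) (c : seq T) :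
  uniq c -> cycle_edges (rev c) = cycle_edges c.
Proof.
move=> Uc; apply/setP=> e; apply/imsetP/imsetP=> [] [u uc ->].
- exists (prev c u); first by rewrite mem_prev -mem_rev.
  by rewrite next_rev // next_prev // setUC.
- exists (next c u); first by rewrite mem_rev mem_next.
  by rewrite next_rev // prev_next // setUC.
Qed.

(** A cycle of length at least 3 never turns back along the edge just used; after rotating [u] to
    the front this is read off from the first three entries. *)
Lemma next_next_neq (T : eqType) (c : seq T) (u : T) :
  uniq c -> 2 < size c -> u \in c -> next c (next c u) != u.
Proof.
move=> Uc sc uc; case: (rot_to uc) => i s e.
rewrite -!(next_rot i Uc) e.
have : uniq (u :: s) by rewrite -e rot_uniq.
have : 2 < size (u :: s) by rewrite -e size_rot.
case: s {e} => [|a [|b s]] //= _; rewrite !inE !negb_or -!andbA.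
case/and5P=> ua ub _ ab _.
by rewrite !eqxx (eq_sym a) (negPf ua) eq_sym.
Qed.

(** A duplicate-free sequence is recovered from its head and its cyclic successor function, so two
    of them can be compared step by step. *)
Lemma uniq_traject_next (T : eqType) (x : T) (s : seq T) :
  uniq (x :: s) -> x :: s = traject (next (x :: s)) x (size (x :: s)).
Proof.
move=> U; have /= := cycle_next U; rewrite rcons_path => /andP[p _].
by rewrite {1}(fpathE p).
Qed.

(* Two closed walks with the same edges and the same first step never part:
   at each vertex the edge leaving it is the one not just traversed. *)
Lemma cycle_edges_inj (T : finType) (x y : T) (c d : seq T) :
  uniq c -> uniq d -> 2 < size c -> size c = size d ->
  take 2 c = [:: x; y] -> take 2 d = [:: x; y] ->
  cycle_edges c = cycle_edges d -> c = d.
Proof.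
case: c => [|x1 [|y1 c]] //; case: d => [|x2 [|y2 d]] //.
move=> Uc Ud sc scd; rewrite /= !take0 => -[? ?] [? ?]; subst x1 x2 y1 y2.
set C := x :: y :: c in Uc sc scd *; set D := x :: y :: d in Ud scd *.
move=> E.
have nC : next C x = y by rewrite /= eqxx.
have nD : next D x = y by rewrite /= eqxx.
have step n : [/\ iter n (next C) x = iter n (next D) x,
   next C (iter n (next C) x) = next D (iter n (next C) x),
   iter n (next C) x \in C & iter n (next C) x \in D].
  elim: n => [|n []]; first by rewrite [iter 0 _ _]/= nC nD !mem_head.
  rewrite !iterS => <-; set u := iter n _ x => e uC uD.
  set v := next C u; have vC : v \in C by rewrite mem_next.
  split=> //; last by rewrite /v e mem_next.
  have : [set v; next C v] \in cycle_edges D.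
    by rewrite -E; apply/imsetP; exists v.
  case/imsetP=> t tD /set2_inj_cases [[<- //]|[ev et]].
  have ut : t = u by apply: (can_inj (prev_next Ud)); rewrite -ev -e.
  by have := next_next_neq Uc sc uC; rewrite -/v et ut eqxx.
rewrite [LHS](uniq_traject_next Uc) [RHS](uniq_traject_next Ud) -/C -/D -scd.
apply: (@eq_from_nth _ x); rewrite !size_traject // => i ilt.
by rewrite !nth_traject //; case: (step i).
Qed.

(** Each cycle through the edge has exactly one vertex sequence beginning with [x], [y]. Uniqueness
    is [cycle_edges_inj]. For existence, rotate [x] to the front, after a reversal if the given
    sequence runs from [y] to [x]. *)
Lemma card_cycles_through_edge (G : sgraph) g (x y : G) :
  2 < g -> adj x y ->
  #|[set C in cycles G g | [set x; y] \in C]| =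
  #|[set c : g.-tuple G | ucycleb (@adj G) c & take 2 c == [:: x; y]]|.
Proof.
move=> g2 xy.
rewrite -(@card_in_imset _ _ (fun c : g.-tuple G => cycle_edges c)); last first.
  move=> c d; rewrite !inE => /andP[/andP[_ Uc] /eqP tc] /andP[/andP[_ Ud] /eqP td].
  move=> E; apply: val_inj; apply: cycle_edges_inj E => //; try exact: tc; try exact: td; by rewrite ?size_tuple.
apply: eq_card => C; rewrite inE; apply/andP/imsetP; last first.
  case=> c; rewrite inE => /andP[Uc /eqP tc] ->; split.
    by apply/imsetP; exists c; rewrite // inE g2.
  apply/imsetP; case: c Uc tc => -[|a [|b c]] //= sz _.
  rewrite take0 => -[-> ->]; exists x; rewrite ?mem_head //= eqxx //.
have rot_case (c : seq G) : size c = g -> ucycleb (@adj G) c -> x \in c ->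
    next c x = y -> exists2 d : g.-tuple G,
    d \in [set c : g.-tuple G | ucycleb (@adj G) c & take 2 c == [:: x; y]]
    & cycle_edges c = cycle_edges d.
  move=> sz /andP[cc Uc] xc nx; case: (rot_to xc) => i s e.
  have szr : size (rot i c) == g by rewrite size_rot sz.
  exists (Tuple szr); last by rewrite /= cycle_edges_rot.
  rewrite inE /ucycleb /= rot_cycle cc rot_uniq Uc /=.
  move: nx; rewrite -(next_rot i Uc) e.
  move: szr; rewrite e; case: (s) => [/= /eqP h|b s' _ /=]; first by rewrite -h in g2.
  by rewrite eqxx take0 => ->.
case=> /imsetP[c]; rewrite inE g2 /= => Uc ->.
have /andP[cc Vc] := Uc.
case/imsetP=> u uc /set2_inj_cases [[xu yn]|[xn yu]].
  by apply: rot_case; rewrite ?size_tuple ?xu ?yn.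
have Ur : ucycleb (@adj G) (rev c).
  rewrite /ucycleb rev_uniq Vc rev_cycle andbT.
  by rewrite (eq_cycle (e' := @adj G)) // => a b; rewrite adj_sym.
have [] := rot_case (rev c).
- by rewrite size_rev size_tuple.
- by [].
- by rewrite mem_rev xn mem_next.
- by rewrite next_rev // xn prev_next.
by move=> d dP e; exists d => //; rewrite -e cycle_edges_rev.
Qed.

(** * Levi graphs of partial linear spaces and their hexagons *)

(** This form is self-dual: it says at once that two points share at most one line and that two
    lines share at most one point. *)
Definition partial_linear (P L : Type) (I : P -> L -> bool) : Prop :=
  forall x y l m, I x l -> I y l -> I x m -> I y m -> x = y \/ l = m.

Definition dual (P L : Type) (I : P -> L -> bool) : L -> P -> bool :=
  fun l x => I x l.

Definition levi_adj (P L : Type) (I : P -> L -> bool) (u v : P + L) : bool :=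
  match u, v with
  | inl x, inr l | inr l, inl x => I x l
  | _, _ => false
  end.

Lemma levi_sym (P L : Type) (I : P -> L -> bool) : symmetric (levi_adj I).
Proof. by move=> [x|l] [y|m]. Qed.

Lemma levi_irrefl (P L : Type) (I : P -> L -> bool) : irreflexive (levi_adj I).
Proof. by case. Qed.

Definition levi (P L : finType) (I : P -> L -> bool) : sgraph :=
  SGraph (levi_sym I) (levi_irrefl I).

Lemma levi_bipartite (P L : finType) (I : P -> L -> bool) : bipartite (levi I).
Proof.
exists [set u : levi I | if (u : P + L) is inl _ then true else false].
by case=> [x|l] [y|m] //=; rewrite !inE.
Qed.

Lemma partial_linear_dual (P L : Type) (I : P -> L -> bool) :
  partial_linear I -> partial_linear (dual I).
Proof. by move=> H l m x y xl xm yl ym; case: (H x y l m); auto. Qed.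

Lemma card_levi_nbr_point (P L : finType) (I : P -> L -> bool) (x : P) :
  #|[set v : levi I | adj (inl x : levi I) v]| = #|[set l | I x l]|.
Proof.
rewrite -(card_imset _ (@inr_inj P L)); apply: eq_card => -[y|l]; rewrite inE /=.
  by apply/esym/negbTE/imsetP=> -[].
by rewrite mem_imset ?inE //; apply: inr_inj.
Qed.

Lemma card_levi_nbr_line (P L : finType) (I : P -> L -> bool) (l : L) :
  #|[set v : levi I | adj (inr l : levi I) v]| = #|[set x | I x l]|.
Proof.
rewrite -(card_imset _ (@inl_inj P L)); apply: eq_card => -[x|m]; rewrite inE /=.
  by rewrite mem_imset ?inE //; apply: inl_inj.
by apply/esym/negbTE/imsetP=> -[].
Qed.

(** Lengths 3 and 5 contradict the alternation of points and lines; a 4-cycle would be two distinct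
    points on two distinct lines. *)
Lemma levi_no_short_cycle (P L : finType) (I : P -> L -> bool) m :
  partial_linear I -> m < 6 -> cycles (levi I) m = set0.
Proof.
move=> lin m6; apply/setP=> C; rewrite inE; apply/imsetP=> -[c].
rewrite inE => /andP[m2 Uc] _; move: m2 m6; rewrite -{1 2}(size_tuple c).
move: (tval c) Uc => {}c; rewrite /ucycleb.
case: c => [|a [|b [|c [|d [|e [|? ?]]]]]] //= + _ _.
- by case: a b c => ? [?|?] [?|?] //=; rewrite ?andbF.
- rewrite !inE !negb_or.
  case: a b c d => x [y|y] [z|z] [t|t] //=; rewrite ?andbF //.
    case/andP=> /and5P[xy zy zt xt _] /and3P[/andP[xz _] yt _].
    by case: (lin x z y t) => // e; move: xz yt; rewrite e eqxx.
  case/andP=> /and5P[yx yz tz tx _] /and3P[/andP[xz _] yt _].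
  by case: (lin y t x z) => // e; move: xz yt; rewrite e eqxx.
- by case: a b c d e => ? [?|?] [?|?] [?|?] [?|?] //=; rewrite ?andbF.
Qed.

(** Such a hexagon reads [p], [l], [p'], [m'], [x], [m]. The line [m'] is determined by [p'] and
    [x], so only its existence is recorded and the hexagons correspond to the triples
    [(p', (m, x))]. *)
Lemma card_levi_hexagons (P L : finType) (I : P -> L -> bool) (p : P) (l : L) :
  partial_linear I -> I p l ->
  #|[set c : 6.-tuple (levi I) | ucycleb (@adj (levi I)) c
                               & take 2 c == [:: inl p : levi I; inr l]]| =
  \sum_(p' | I p' l && (p' != p)) \sum_(m | I p m && (m != l))
     #|[set x | [&& I x m, x != p & [exists m', I p' m' && I x m']]]|.
Proof.
move=> lin pl.
under eq_bigr => p' _ do under eq_bigr => m _ do rewrite -sum1_card.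
under eq_bigr => p' _ do rewrite pair_big_dep.
rewrite pair_big_dep sum1_card /=.
(* The line [m'] is recovered from [p'] and [x]. The default [l] is never reached on the triples
   counted, where a joining line exists. *)
pose side (p' x : P) := odflt l [pick m' | I p' m' && I x m'].
pose F (t : P * (L * P)) : 6.-tuple (levi I) :=
  [tuple inl p; inr l; inl t.1; inr (side t.1 t.2.2); inl t.2.2; inr t.2.1].
have Finj : injective F.
  by move=> [a [b d]] [a' [b' d']] /(congr1 val) /= [-> _ -> ->].
rewrite -(card_imset _ Finj); apply: eq_card => c; rewrite inE.
have side_uniq a b d : a != b -> I a d -> I b d -> side a b = d.
  move=> ab ad bd; rewrite /side; case: pickP => [e /andP[ae be]|/(_ d)] /=.
    by case: (lin a b e d) => // e'; rewrite e' eqxx in ab.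
  by rewrite ad bd.
apply/andP/imsetP.
  case: c => -[|a1 [|a2 [|a3 [|a4 [|a5 [|a6 [|? ?]]]]]]] //= sz.
  move=> [+ /eqP[e1 e2]]; subst a1 a2; rewrite /ucycleb /=.
  case: a3 a4 a5 a6 sz => [a3|a3] [a4|a4] [a5|a5] [a6|a6] sz //=;
    rewrite ?andbF // andbT => /andP[/and5P[_ a3l a34 a54 /andP[a56 pa6]]].
  rewrite !inE !negb_or /=.
  case/and5P=> /and3P[p3 p5 _] /andP[_ l6] /andP[a35 _] _ _.
  have {}p3 : a3 != p by rewrite eq_sym.
  have {}p5 : a5 != p by rewrite eq_sym.
  have {}l6 : a6 != l by rewrite eq_sym.
  exists (a3, (a6, a5)).
    rewrite unfold_in /= a3l p3 pa6 l6 inE a56 p5 /=.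
    by apply/existsP; exists a4; rewrite a34.
  by apply: val_inj; rewrite /= (side_uniq _ _ a4).
case=> -[p' [m x]]; rewrite unfold_in /= => /andP[/andP[p'l p'p] /andP[/andP[pm ml]]].
rewrite inE => /and3P[xm xp /existsP[m' /andP[p'm' xm']]] ->.
split=> //.
(* Each of the next three coincidences would place [p] and a second point on both [l] and [m],
   forcing [m = l]. *)
have p'x : p' != x.
  apply/eqP=> e; subst x.
  by case: (lin p p' l m) => // e; rewrite e eqxx in p'p ml.
rewrite /F /= (side_uniq _ _ m') // /ucycleb /= pl p'l p'm' xm' xm pm /=.
have lm' : l != m'.
  apply/eqP=> e; subst m'.
  by case: (lin p x l m) => // e; move: xp ml; rewrite e eqxx.
have m'm : m' != m.
  apply/eqP=> e; subst m'.
  by case: (lin p p' l m) => // e; move: p'p ml; rewrite e eqxx.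
rewrite !inE !negb_or /=.
apply/and5P; split=> //; apply/and3P || apply/andP; split=> //.
- by rewrite eq_sym.
- by rewrite eq_sym.
- by rewrite eq_sym.
Qed.

(** Any two points are joined by a walk of four edges, and every line is adjacent to some point. *)
Lemma levi_connected (P L : finType) (I : P -> L -> bool) (x0 : P) :
  (forall l, exists x, I x l) ->
  (forall x y, exists l z m, [&& I x l, I z l, I z m & I y m]) ->
  connected_graph (levi I).
Proof.
move=> Hl Hp; split; first by apply/card_gt0P; exists (inl x0).
have step (x : P) l : I x l -> connect (@adj (levi I)) (inl x) (inr l).
  by move=> xl; apply: connect1.
have csym : connect_sym (@adj (levi I)) by apply: sym_connect_sym; apply: adj_sym.
have step' (x : P) l : I x l -> connect (@adj (levi I)) (inr l) (inl x).
  by move=> xl; rewrite csym; apply: step.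
have pp x y : connect (@adj (levi I)) (inl x) (inl y).
  have [l [z [m /and4P[xl zl zm ym]]]] := Hp x y.
  apply: connect_trans (step _ _ xl) (connect_trans (step' _ _ zl) _).
  exact: connect_trans (step _ _ zm) (step' _ _ ym).
have toP (u : levi I) : exists x, connect (@adj (levi I)) u (inl x).
  case: u => [x|l]; first by exists x.
  by have [x xl] := Hl l; exists x; apply: step'.
move=> u v; have [x ux] := toP u; have [y vy] := toP v.
by apply: connect_trans ux (connect_trans (pp x y) _); rewrite csym.
Qed.

(** Positivity of [n], [k] and [lambda] yields a point, a flag and a hexagon through it, so the
    girth is not larger than 6. Edges are unordered pairs, so the count starting at the point of a
    flag serves both orientations. *)
Lemma levi_egr (P L : finType) (I : P -> L -> bool) n k lambda :
  partial_linear I -> connected_graph (levi I) ->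
  #|P| = n -> #|L| = n -> 0 < n -> 0 < k -> 0 < lambda ->
  (forall x, #|[set l | I x l]| = k) -> (forall l, #|[set x | I x l]| = k) ->
  (forall p l, I p l ->
     \sum_(p' | I p' l && (p' != p)) \sum_(m | I p m && (m != l))
       #|[set x | [&& I x m, x != p & [exists m', I p' m' && I x m']]]|
     = lambda) ->
  egr (levi I) (2 * n) k 6 lambda.
Proof.
move=> lin conn cP cL n0 k0 la0 degP degL hex.
have through (u v : levi I) : adj u v ->
    #|[set C in cycles (levi I) 6 | [set u; v] \in C]| = lambda.
  case: u v => [x|l] [y|m] // uv; last rewrite setUC;
    by rewrite card_cycles_through_edge // card_levi_hexagons // hex.
split; last exact: through.
- split=> //.
    by case=> [x|l]; rewrite ?card_levi_nbr_point ?card_levi_nbr_line.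
  split; last by move=> m m6; apply: levi_no_short_cycle.
  have /card_gt0P[p _] : 0 < #|P| by rewrite cP.
  have /card_gt0P[l] : 0 < #|[set l | I p l]| by rewrite degP.
  rewrite inE => pl.
  have /card_gt0P[C] : 0 < #|[set C in cycles (levi I) 6
      | [set (inl p : levi I); inr l] \in C]| by rewrite through.
  by rewrite inE => /andP[C6 _]; apply/set0Pn; exists C.
- by rewrite card_sum cP cL mul2n addnn.
Qed.

(** * Counting tools: double counting and subtypes *)

Lemma double_count (T U : finType) (A : {set T}) (B : {set U})
    (R : T -> U -> bool) r s :
  {in A, forall a, #|[set b in B | R a b]| = r} ->
  {in B, forall b, #|[set a in A | R a b]| = s} ->
  #|A| * r = #|B| * s.
Proof.
move=> HA HB; rewrite -!sum_nat_const.
rewrite -(eq_bigr _ HA) -(eq_bigr _ HB).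
under eq_bigr do rewrite -sum1dep_card.
under [RHS]eq_bigr do rewrite -sum1dep_card.
rewrite (exchange_big_dep (mem B)) /= => [|a b _ /andP[] //].
by apply: eq_bigr => b bB; apply: eq_bigl => a; rewrite bB.
Qed.

Lemma card_sig_set (T : finType) (a b : pred T) :
  #|[set u : {x | a x} | b (val u)]| = #|[set x | a x && b x]|.
Proof.
rewrite -(card_imset _ val_inj); apply: eq_card => x; rewrite inE.
apply/imsetP/andP=> [[u + ->]|[ax bx]]; first by rewrite inE (valP u).
by exists (exist _ x ax); rewrite // inE.
Qed.

Lemma exists_sig (T : finType) (a b : pred T) :
  [exists u : {x | a x}, b (val u)] = [exists x, a x && b x].
Proof.
apply/existsP/existsP=> [[u bu]|[x /andP[ax bx]]].
  by exists (val u); rewrite (valP u).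
by exists (exist _ x ax).
Qed.

(** * Projective planes of order [q] in self-dual form *)

(** Including the pencil sizes makes these conditions invariant under duality, so each count of
    points also yields one of lines. *)
Record is_plane (P L : finType) (I : P -> L -> bool) (q : nat) : Prop := IsPlane {
  plane_linear : partial_linear I;
  plane_join : forall x y, x != y -> exists l, I x l && I y l;
  plane_meet : forall l m, l != m -> exists x, I x l && I x m;
  plane_card_line : forall l, #|[set x | I x l]| = q.+1;
  plane_card_pencil : forall x, #|[set l | I x l]| = q.+1
}.

Lemma is_plane_dual (P L : finType) (I : P -> L -> bool) q :
  is_plane I q -> is_plane (dual I) q.
Proof. by case=> lin j m cl cp; split=> //; apply: partial_linear_dual. Qed.

Lemma card1_of_unique (T : finType) (A : {set T}) a :
  a \in A -> (forall b, b \in A -> b = a) -> #|A| = 1.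
Proof.
move=> aA H; rewrite -(cards1 a); apply: eq_card => b; rewrite inE.
by apply/idP/eqP=> [/H|->].
Qed.

(** For the pencil at [x], choose a line [l] missing [x]: joining with [x] and intersecting with [l]
    match the points of [l] with the lines through [x]. The quadrangle ensures that such an [l]
    exists. *)
Lemma projective_plane_is_plane (Pi : projective_plane) q :
  0 < q -> plane_order Pi q ->
  is_plane (@incident Pi) q /\ exists l : line Pi, True.
Proof.
move=> q0 ord.
have lin : partial_linear (@incident Pi).
  move=> x y l m xl yl xm ym; case: (eqVneq x y) => [|xy]; first by left.
  have [n [_ un]] := join_unique xy.
  by right; rewrite -(un l) ?xl // -(un m) ?xm.
have join (x y : point Pi) : x != y -> exists l, incident x l && incident y l.
  by move=> /join_unique[l [? _]]; exists l.
have meet (l m : line Pi) : l != m -> exists x, incident x l && incident x m.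
  by move=> /meet_unique[x [? _]]; exists x.
have [Q [Q4 Q2]] := quadrangle Pi.
have off (l : line Pi) : exists y, ~~ incident y l.
  case: (pickP (fun y => ~~ incident y l)) => [y yl|al]; first by exists y.
  have := Q2 l; suff -> : [set x in Q | incident x l] = Q by rewrite Q4.
  by apply/setP=> x; rewrite inE; have /negbFE -> := al x; rewrite andbT.
have [l0 _] : exists l : line Pi, True.
  have /card_gt1P[x [y [_ _ xy]]] : 1 < #|Q| by rewrite Q4.
  by have [l _] := join _ _ xy; exists l.
have offp (x : point Pi) : exists l, ~~ incident x l.
  case: (boolP (incident x l0)) => [xl|]; last by exists l0.
  (* When [x] lies on [l0], join a point [y] off [l0] to a point [z] of [l0] other than [x]; this
     line misses [x]. *)
  have [y yl] := off l0.
  have [z zl zx] : exists2 z, incident z l0 & z != x.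
    have /card_gt0P[z] : 0 < #|[set z | incident z l0] :\ x|.
      by move: (ord l0); rewrite (cardsD1 x) inE xl add1n => -[->].
    by rewrite !inE => /andP[zx zl]; exists z.
  have yz : y != z by apply: contraNneq yl => ->.
  have [m /andP[ym zm]] := join _ _ yz.
  exists m; apply/negP=> xm.
  by case: (lin x z l0 m) => // e; [rewrite e eqxx in zx | rewrite e ym in yl].
split; last by exists l0.
split=> // x.
have [l xl] := offp x.
rewrite -(ord l) -[LHS]muln1 -[RHS]muln1; apply/esym.
apply: (double_count (R := @incident Pi)) => [y|m]; rewrite inE => h.
- have xy : x != y by apply: contraNneq xl => ->.
  have [m /andP[xm ym]] := join _ _ xy.
  apply: (@card1_of_unique _ _ m); first by rewrite !inE xm.
  move=> n; rewrite !inE => /andP[xn yn].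
  by case: (lin x y n m) => // e; rewrite e eqxx in xy.
- have lm : l != m by apply: contraNneq xl => ->.
  have [y /andP[yl ym]] := meet _ _ lm.
  apply: (@card1_of_unique _ _ y); first by rewrite !inE yl.
  move=> z; rewrite !inE => /andP[zl zm].
  by case: (lin z y l m) => // e; rewrite e eqxx in lm.
Qed.

(** * The deleted configuration and the counts of what remains *)

(** The conditions are preserved when points and lines are exchanged: [l1] joins [p1] and [p2], just
    as [p1] is where [l1] and [l2] meet. *)
Record frame (P L : Type) (I : P -> L -> bool) (p1 p2 : P) (l1 l2 : L) : Prop :=
  Frame {
    frame_11 : I p1 l1;
    frame_21 : I p2 l1;
    frame_12 : I p1 l2;
    frame_points : p1 <> p2;
    frame_lines : l1 <> l2
  }.

Lemma frame_dual (P L : Type) (I : P -> L -> bool) p1 p2 l1 l2 :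
  frame I p1 p2 l1 l2 -> frame (dual I) l1 l2 p1 p2.
Proof. by case. Qed.

(** Applied to [dual I] with [p1] and [p2], the same predicate selects the kept lines. *)
Definition kept (P L : Type) (I : P -> L -> bool) (l1 l2 : L) (x : P) : bool :=
  ~~ I x l1 && ~~ I x l2.

Lemma exists_frame (P L : finType) (I : P -> L -> bool) q (l : L) :
  0 < q -> is_plane I q -> exists p1 p2 l1 l2, frame I p1 p2 l1 l2.
Proof.
move=> q0 [_ _ _ cl cp].
have /card_gt1P[x [y]] : 1 < #|[set x | I x l]| by rewrite cl.
rewrite !inE => -[xl yl /eqP xy].
have /card_gt0P[m] : 0 < #|[set m | I x m] :\ l|.
  by move: (cp x); rewrite (cardsD1 l) inE xl add1n => -[->].
rewrite !inE => /andP[/eqP ml xm].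
by exists x, y, l, m; split=> //; apply/nesym.
Qed.

(** The line loses its intersections with [l1] and [l2], which differ because [l1] and [l2] meet
    only in [p1], a point off [l]. *)
Lemma card_kept_on_line (P L : finType) (I : P -> L -> bool) q p1 p2 l1 l2 l :
  is_plane I q -> frame I p1 p2 l1 l2 -> kept (dual I) p1 p2 l ->
  #|[set x | I x l && kept I l1 l2 x]| = q - 1.
Proof.
move=> [lin jn mt cl cp] [p11 p21 p12 pp ll] /andP[p1l p2l].
rewrite /dual in p1l p2l.
have [a /andP[al al1]] : exists a, I a l && I a l1.
  by apply: mt; apply: contraNneq p1l => ->.
have [b /andP[bl bl2]] : exists b, I b l && I b l2.
  by apply: mt; apply: contraNneq p1l => ->.
have ab : a != b.
  apply/eqP=> e; subst b.
  by case: (lin a p1 l1 l2) => // e; rewrite -e al in p1l.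
have -> : [set x | I x l && kept I l1 l2 x] = [set x | I x l] :\ a :\ b.
  apply/setP=> x; rewrite !inE /kept.
  case: (boolP (I x l)) => xl; rewrite ?andbF //= andbT andbC.
  congr (_ && _); congr (~~ _); apply/idP/eqP=> [h|-> //].
    by case: (lin x b l l2) => // e; rewrite e p12 in p1l.
  by case: (lin x a l l1) => // e; rewrite e p11 in p1l.
have := cl l; rewrite (cardsD1 a) inE al (cardsD1 b) !inE eq_sym ab bl /=; lia.
Qed.

(** The q - 1 lines through [p1] other than [l1] and [l2] partition the kept points, and each of
    them loses only [p1]. *)
Lemma card_kept (P L : finType) (I : P -> L -> bool) q p1 p2 l1 l2 :
  0 < q -> is_plane I q -> frame I p1 p2 l1 l2 ->
  #|[set x | kept I l1 l2 x]| = q ^ 2 - q.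
Proof.
move=> q0 [lin jn mt cl cp] [p11 p21 p12 /eqP pp /eqP ll].
pose B := [set l | I p1 l] :\ l1 :\ l2.
have cB : #|B| = q - 1.
  have := cp p1; rewrite (cardsD1 l1) inE p11 (cardsD1 l2) !inE eq_sym ll p12 /=.
  by rewrite -/B; lia.
suff : #|[set x | kept I l1 l2 x]| * 1 = #|B| * q by rewrite cB muln1 mulnBl mul1n mulnn.
apply: (double_count (R := I)) => [x|l].
  rewrite inE => /andP[x1 x2].
  have xp : x != p1 by apply: contraNneq x1 => ->.
  have [l /andP[xl p1l]] := jn _ _ xp.
  apply: (@card1_of_unique _ _ l).
    rewrite !inE xl p1l andbT andbT; apply/andP; split.
      by apply: contraNneq x2 => <-.
    by apply: contraNneq x1 => <-.
  move=> m; rewrite !inE => /andP[/and3P[_ _ p1m] xm].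
  by case: (lin x p1 m l) => // e; rewrite e eqxx in xp.
rewrite !inE => /and3P[l_2 l_1 p1l].
have -> : [set x in [set x | kept I l1 l2 x] | I x l] = [set x | I x l] :\ p1.
  apply/setP=> x; rewrite !inE /kept; case: (eqVneq x p1) => [->|xp] /=.
    by rewrite p11.
  case: (boolP (I x l)) => xl; rewrite ?andbF // andbT.
  apply/andP; split; apply/negP=> h.
    by case: (lin x p1 l l1) => // e; [rewrite e eqxx in xp | rewrite e eqxx in l_1].
  by case: (lin x p1 l l2) => // e; [rewrite e eqxx in xp | rewrite e eqxx in l_2].
by have := cl l; rewrite (cardsD1 p1) inE p1l add1n => -[->].
Qed.

(** Of the q - 1 kept points of [m], discard [p] and the intersections [y], [z] of [m] with the
    lines from [p'] to [p1] and [p2]. The point [z] is itself kept only if [m] misses [w], whence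
    the term [I w m]. *)
Lemma card_third_vertex (P L : finType) (I : P -> L -> bool) q p1 p2 l1 l2
    p p' l m b w :
  3 < q -> is_plane I q -> frame I p1 p2 l1 l2 ->
  kept (dual I) p1 p2 l -> kept (dual I) p1 p2 m ->
  kept I l1 l2 p -> kept I l1 l2 p' ->
  I p l -> I p' l -> p' != p -> I p m -> m != l ->
  I p' b -> I p2 b -> I w b -> I w l2 ->
  #|[set x | kept I l1 l2 x && [&& I x m, x != p
      & [exists m', kept (dual I) p1 p2 m' && (I p' m' && I x m')]]]|
  = (q - 4) + I w m.
Proof.
move=> q3 pl fr kl km kp kp' hpl hp'l p'p hpm ml p'b p2b wb wl2.
have := card_kept_on_line pl fr km.
case: pl => [lin jn mt cl cp]; case: fr => [p11 p21 p12 /eqP pp /eqP ll].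
move: kl km (kp) (kp') => /andP[p1l p2l] /andP[p1m p2m] /andP[pl1 pl2] /andP[p'1 p'2].
rewrite /dual in p1l p2l p1m p2m.
have p'm : ~~ I p' m.
  apply/negP=> h; case: (lin p p' m l) => // e; first by rewrite e eqxx in p'p.
  by rewrite e eqxx in ml.
have [a /andP[p'a p1a]] : exists a, I p' a && I p1 a.
  by apply: jn; apply: contraNneq p'1 => ->.
have ab : a != b.
  apply/eqP=> e; subst b; case: (lin p1 p2 a l1) => // e; first by rewrite e eqxx in pp.
  by rewrite -e p'a in p'1.
have [y /andP[ym ya]] : exists y, I y m && I y a.
  by apply: mt; apply: contraNneq p'm => ->.
have [z /andP[zm zb]] : exists z, I z m && I z b.
  by apply: mt; apply: contraNneq p'm => ->.
have yz : y != z.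
  apply/eqP=> e; subst z; case: (lin y p' a b) => // e; last by rewrite e eqxx in ab.
  by rewrite -e ym in p'm.
have yp : y != p.
  apply/eqP=> e; subst y; case: (lin p p' a l) => // e; first by rewrite e eqxx in p'p.
  by rewrite -e p1a in p1l.
have zp : z != p.
  apply/eqP=> e; subst z; case: (lin p p' b l) => // e; first by rewrite e eqxx in p'p.
  by rewrite -e p2b in p2l.
(* The line [a] meets both [l1] and [l2] in [p1], which is not on [m]. *)
have ky : kept I l1 l2 y.
  have yp1 : y <> p1 by move=> e; rewrite e (negPf p1m) in ym.
  apply/andP; split; apply/negP=> h.
    by case: (lin y p1 a l1) => // e; rewrite -e p'a in p'1.
  by case: (lin y p1 a l2) => // e; rewrite -e p'a in p'2.
have bl2 : b <> l2 by move=> e; rewrite -e p'b in p'2.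
(* The line [b] meets [l1] in [p2], which is off [m], and meets [l2] in [w]; so [z] is lost exactly
   when it equals [w]. *)
have kz : kept I l1 l2 z = ~~ I w m.
  rewrite /kept; have -> : I z l1 = false.
    apply/negP=> h; case: (lin z p2 b l1) => // e; first by rewrite e (negPf p2m) in zm.
    by rewrite -e p'b in p'1.
  congr (~~ _); apply/idP/idP=> h.
    by case: (lin z w b l2) => // e; rewrite -e.
  by case: (lin z w b m) => // e; [rewrite e | rewrite -e p'b in p'm].
set S := [set x | I x m && kept I l1 l2 x] => cS.
have -> : [set x | kept I l1 l2 x && [&& I x m, x != p
      & [exists m', kept (dual I) p1 p2 m' && (I p' m' && I x m')]]]
    = S :\ p :\ y :\ z.
  apply/setP=> x; rewrite !inE.
  case: (boolP (kept I l1 l2 x)) => [/andP[x1 x2]|]; rewrite ?andbF //=.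
  case: (boolP (I x m)) => xm; rewrite ?andbF //=.
  case: (boolP (x != p)) => xp; rewrite ?andbF //= andbT.
  apply/existsP/andP=> [[n /and3P[/andP[p1n p2n] p'n xn]]|[xz xy]].
    rewrite /dual in p1n p2n; split; apply/eqP=> e; subst x.
      case: (lin z p' n b) => // e; first by rewrite -e zm in p'm.
      by rewrite e p2b in p2n.
    case: (lin y p' n a) => // e; first by rewrite -e ym in p'm.
    by rewrite e p1a in p1n.
  have [n /andP[p'n xn]] : exists n, I p' n && I x n.
    by apply: jn; apply: contraNneq p'm => ->.
  exists n; rewrite p'n xn andbT andbT; apply/andP; split; apply/negP=> h.
    case: (lin p1 p' n a) => // e; first by rewrite -e p11 in p'1.
    subst n; case: (lin x y a m) => // e; first by rewrite e eqxx in xy.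
    by rewrite -e p1a in p1m.
  case: (lin p2 p' n b) => // e; first by rewrite -e p21 in p'1.
  subst n; case: (lin x z b m) => // e; first by rewrite e eqxx in xz.
  by rewrite -e p2b in p2m.
move: cS.
rewrite (cardsD1 p S) (cardsD1 y (S :\ p)) (cardsD1 z (S :\ p :\ y)).
rewrite !inE hpm kp yp ym ky zp zm (eq_sym z) yz kz /=.
by move: (#|_|) (I w m) q3 => k [] q3 /=; clear -q3; lia.
Qed.

(** * The geometry of kept points and lines: regularity, connectedness, hexagon count *)

Definition kept_incident (P L : finType) (I : P -> L -> bool) p1 p2 l1 l2
    (x : {x | kept I l1 l2 x}) (l : {l | kept (dual I) p1 p2 l}) : bool :=
  I (val x) (val l).

Lemma kept_linear (P L : finType) (I : P -> L -> bool) q p1 p2 l1 l2 :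
  is_plane I q -> partial_linear (@kept_incident P L I p1 p2 l1 l2).
Proof.
case=> lin _ _ _ _ x y l m xl yl xm ym.
by case: (lin _ _ _ _ xl yl xm ym) => /val_inj; auto.
Qed.

Lemma kept_card_line (P L : finType) (I : P -> L -> bool) q p1 p2 l1 l2 :
  is_plane I q -> frame I p1 p2 l1 l2 ->
  forall l, #|[set x | @kept_incident P L I p1 p2 l1 l2 x l]| = q - 1.
Proof.
move=> pl fr l.
rewrite (@card_sig_set _ (kept I l1 l2) (fun x => I x (val l))).
rewrite -(card_kept_on_line pl fr (valP l)).
by apply: eq_card => x; rewrite !inE andbC.
Qed.

Lemma kept_card_pencil (P L : finType) (I : P -> L -> bool) q p1 p2 l1 l2 :
  is_plane I q -> frame I p1 p2 l1 l2 ->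
  forall x, #|[set l | @kept_incident P L I p1 p2 l1 l2 x l]| = q - 1.
Proof.
move=> pl fr x.
exact: (kept_card_line (is_plane_dual pl) (frame_dual fr) x).
Qed.

(* When the line [n] joining [x] and [y] was removed because it passes through
   [r], a kept line [m] through [x] has a kept point other than [x] and other
   than its intersection with the line joining [y] to the second centre [s]. *)
Lemma kept_two_step (P L : finType) (I : P -> L -> bool) q p1 p2 l1 l2 :
  3 < q -> is_plane I q -> frame I p1 p2 l1 l2 ->
  forall x y, exists l z m, [&& @kept_incident P L I p1 p2 l1 l2 x l,
    @kept_incident P L I p1 p2 l1 l2 z l,
    @kept_incident P L I p1 p2 l1 l2 z m & @kept_incident P L I p1 p2 l1 l2 y m].
Proof.
move=> q3 pl fr x y; case: (eqVneq x y) => [<-|xy].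
  have /card_gt0P[l] : 0 < #|[set l | @kept_incident P L I p1 p2 l1 l2 x l]|.
    by rewrite (kept_card_pencil pl fr); lia.
  by rewrite inE => xl; exists l, x, l; rewrite !xl.
have {}xy : val x != val y by [].
case: (pl) => lin jn mt _ _.
have [n /andP[xn yn]] := jn _ _ xy.
case: (boolP (kept (dual I) p1 p2 n)) => [kn|].
  by exists (exist _ n kn), x, (exist _ n kn); rewrite /kept_incident /= xn yn.
have /card_gt0P[m] : 0 < #|[set l | @kept_incident P L I p1 p2 l1 l2 x l]|.
  by rewrite (kept_card_pencil pl fr); lia.
rewrite inE => xm.
(* Here [r] is the centre on [n] and [s] the other one; [keptE] lets the two cases share one
   argument. *)
have two_step r s : I r l1 -> I s l1 -> I r n ->
    (forall k, kept (dual I) p1 p2 k = ~~ I r k && ~~ I s k) ->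
    exists l z m, [&& @kept_incident P L I p1 p2 l1 l2 x l,
      @kept_incident P L I p1 p2 l1 l2 z l,
      @kept_incident P L I p1 p2 l1 l2 z m & @kept_incident P L I p1 p2 l1 l2 y m].
  move=> r1 s1 rn keptE.
  have /andP[y1 _] := valP y.
  have := valP m; rewrite keptE => /andP[rm sm].
  have [b /andP[yb sb]] : exists b, I (val y) b && I s b.
    by apply: jn; apply: contraNneq y1 => ->.
  have [z0 /andP[z0m z0b]] : exists z0, I z0 (val m) && I z0 b.
    by apply: mt; apply: contraNneq sm => ->.
  have mn : val m <> n by move=> e; rewrite e rn in rm.
  have ym : ~~ I (val y) (val m).
    apply/negP=> h; case: (lin _ _ _ _ xm h xn yn) => // e.
    by rewrite e eqxx in xy.
  (* Without [x], the line [m] still has q - 2 > 1 kept points, so one of them avoids [z0]. *)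
  pose S := [set z | @kept_incident P L I p1 p2 l1 l2 z m] :\ x.
  have S1 : 1 < #|S|.
    have := kept_card_line pl fr m; rewrite (cardsD1 x) inE xm add1n -/S.
    by move: #|S| q3; clear=> k; lia.
  have [z zS zz0] : exists2 z, z \in S & val z != z0.
    have /card_gt1P[z [z' [zS z'S zz']]] := S1.
    case: (eqVneq (val z) z0) => [e|]; last by exists z.
    by exists z' => //; rewrite -e eq_sym.
  move: zS; rewrite !inE => /andP[zx zm].
  have [k /andP[zk yk]] : exists k, I (val z) k && I (val y) k.
    by apply: jn; apply: contraNneq ym => <-.
  (* If [r] were on [k], then [k = n] and [z = x]; if [s] were, then [k = b] and [z = z0]. *)
  have kk : kept (dual I) p1 p2 k.
    rewrite keptE; apply/andP; split; apply/negP=> h.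
      case: (lin _ _ _ _ yk h yn rn) => e; first by rewrite e r1 in y1.
      subst k; case: (lin _ _ _ _ zk xn zm xm) => // e.
        by rewrite -val_eqE e eqxx in zx.
      by rewrite e in mn.
    case: (lin _ _ _ _ yk h yb sb) => e; first by rewrite e s1 in y1.
    subst k; case: (lin _ _ _ _ zk z0b zm z0m) => e.
      by rewrite e eqxx in zz0.
    by rewrite -e sb in sm.
  by exists m, z, (exist _ k kk); rewrite xm zm /kept_incident /= zk yk.
case: fr => p11 p21 _ _ _; rewrite negb_and !negbK => /orP[] h.
  exact: (two_step p1 p2).
by apply: (two_step p2 p1) => // k; rewrite andbC.
Qed.

(** The point [w] depends only on [p'], so the terms [I w m], summed over [m], count just the line
    joining [p] to [w]. *)
Lemma kept_hexagons (P L : finType) (I : P -> L -> bool) q p1 p2 l1 l2 :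
  3 < q -> is_plane I q -> frame I p1 p2 l1 l2 ->
  forall p l, @kept_incident P L I p1 p2 l1 l2 p l ->
     \sum_(p' | kept_incident p' l && (p' != p))
     \sum_(m : {l | kept (dual I) p1 p2 l} | kept_incident p m && (m != l))
       #|[set x | [&& kept_incident x m, x != p
          & [exists m' : {l | kept (dual I) p1 p2 l},
               kept_incident p' m' && kept_incident x m']]]|
     = (q - 2) * (q - 3) ^ 2.
Proof.
move=> q3 pl fr p l hpl.
have inner p' : kept_incident p' l && (p' != p) ->
    \sum_(m : {l | kept (dual I) p1 p2 l} | kept_incident p m && (m != l))
       #|[set x | [&& kept_incident x m, x != p
          & [exists m' : {l | kept (dual I) p1 p2 l},
               kept_incident p' m' && kept_incident x m']]]| = (q - 3) ^ 2.
  case/andP=> hp'l p'p.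
  case: (pl) => lin jn mt _ _; case: (fr) => p11 p21 p12 pp ll.
  have /andP[pl1 pl2] := valP p; have /andP[p'1 p'2] := valP p'.
  have lineE z k k' : k = k' -> I z k = I z k' by move=> ->.
  have /andP[p1l p2l] := valP l; rewrite /dual in p1l p2l.
  have [b /andP[p'b p2b]] : exists b, I (val p') b && I p2 b.
    by apply: jn; apply: contraNneq p'1 => ->.
  have [w /andP[wb wl2]] : exists w, I w b && I w l2.
    by apply: mt; apply/eqP=> e; move: p'b; rewrite (lineE _ _ _ e) (negPf p'2).
  have [u /andP[pu wu]] : exists u, I (val p) u && I w u.
    by apply: jn; apply: contraNneq pl2 => ->.
  (* The line [u] is one of the lines [m] summed over. Through [p1] it would be [l2], which misses
     [p]; through [p2] it would be [b], hence [l], which misses [p2]. *)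
  have ku : kept (dual I) p1 p2 u.
    rewrite /kept /dual; apply/andP; split; apply/negP=> h.
      have wp1 : w <> p1.
        move=> e; subst w; case: (lin p1 p2 b l1) => // e.
        by rewrite -(lineE _ _ _ e) p'b in p'1.
      by case: (lin w p1 u l2) => // e; rewrite -(lineE _ _ _ e) pu in pl2.
    have wp2 : w <> p2.
      move=> e; subst w; case: (lin p1 p2 l1 l2) => //.
    case: (lin w p2 u b) => // e; subst u.
    case: (lin (val p) (val p') b (val l)) => // e; last by rewrite -e p2b in p2l.
    by rewrite -val_eqE e eqxx in p'p.
  have ul : u != val l.
    apply/eqP=> e; case: (lin w (val p') u b) => //; first by rewrite e.
      by move=> e'; rewrite -e' wl2 in p'2.
    by move=> e'; rewrite -e e' p2b in p2l.
  have S2 : #|[set m | @kept_incident P L I p1 p2 l1 l2 p m && (m != l)]| = q - 2.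
    have := kept_card_pencil pl fr p; rewrite (cardsD1 l) inE hpl add1n => e.
    have -> : q - 2 = (q - 1).-1 by clear -q3; lia.
    by rewrite -e; apply: eq_card => m; rewrite !inE andbC.
  have S1 : #|[set m | (@kept_incident P L I p1 p2 l1 l2 p m && (m != l))
                     && I w (val m)]| = 1.
    apply: (@card1_of_unique _ _ (exist _ u ku)).
      by rewrite inE /kept_incident /= pu wu andbT.
    move=> m; rewrite inE => /andP[/andP[pm _] wm]; apply: val_inj => /=.
    case: (lin w (val p) (val m) u) => // e.
    by rewrite -e wl2 in pl2.
  (* The cardinal and the inner existential pass from the subtypes to the whole plane, to match
     [card_third_vertex]. *)
  under eq_bigr => m /andP[pm ml].
    rewrite (@card_sig_set _ (kept I l1 l2) (fun x => [&& I x (val m), x != val p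
      & [exists m' : {l | kept (dual I) p1 p2 l},
               I (val p') (val m') && I x (val m')]])).
    have E x : [exists m' : {l | kept (dual I) p1 p2 l},
               I (val p') (val m') && I x (val m')] =
      [exists m', kept (dual I) p1 p2 m' && (I (val p') m' && I x m')].
      exact: (@exists_sig _ _ (fun m' => I (val p') m' && I x m')).
    under eq_finset => x do rewrite E.
    rewrite (card_third_vertex q3 pl fr (valP l) (valP m) (valP p) (valP p')
      hpl hp'l p'p pm ml p'b p2b wb wl2).
    over.
  rewrite big_split /= sum_nat_const -cardsE S2.
  have -> : \sum_(m | @kept_incident P L I p1 p2 l1 l2 p m && (m != l))
      I w (val m) = 1.
    apply: etrans S1; rewrite -sum1dep_card [RHS]big_mkcondr /=.
    by apply: eq_bigr => m _; case: ifP.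
  (* With q = k + 4 the truncated subtractions are exact and the identity is (k + 2) k + 1 = (k +
     1)^2. *)
  by move: q3; clear; case: q => [|[|[|[|k]]]] // _; rewrite !subSS !subn0; nia.
rewrite (eq_bigr _ inner) sum_nat_const; congr (_ * _).
have := kept_card_line pl fr l; rewrite (cardsD1 p) inE hpl add1n => e.
have -> : q - 2 = (q - 1).-1 by clear -q3; lia.
by rewrite -e; apply: eq_card => m; rewrite !inE andbC.
Qed.

(** * The Levi graph of the kept geometry in a plane of order [q] *)

Theorem theorem2p4 (q : nat) (hq : 3 < q)
    (hPi : exists Pi : projective_plane, plane_order Pi q) :
  exists G : sgraph, bipartite G /\
    egr G (2 * (q ^ 2 - q)) (q - 1) 6 ((q - 2) * (q - 3) ^ 2).
Proof.
have q0 : 0 < q by lia.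
case: hPi => Pi /(projective_plane_is_plane q0)[pl [l _]].
have [p1 [p2 [l1 [l2 fr]]]] := exists_frame l q0 pl.
exists (levi (@kept_incident _ _ (@incident Pi) p1 p2 l1 l2)).
split; first exact: levi_bipartite.
have cP := card_kept q0 pl fr.
have n0 : 0 < q ^ 2 - q by rewrite subn_gt0 -{1}(expn1 q) ltn_exp2l //; lia.
have [x0 kx0] : exists x, kept (@incident Pi) l1 l2 x.
  have /card_gt0P[x] : 0 < #|[set x | kept (@incident Pi) l1 l2 x]| by rewrite cP.
  by rewrite inE; exists x.
apply: levi_egr => //.
- exact: kept_linear pl.
- apply: levi_connected; first exact: (exist _ x0 kx0).
    move=> m; have /card_gt0P[x] : 0 < #|[set x | @kept_incident _ _ (@incident Pi) p1 p2 l1 l2 x m]|.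
      by rewrite (kept_card_line pl fr); lia.
    by rewrite inE; exists x.
  exact: kept_two_step pl fr.
- by rewrite card_sig -cP; apply: eq_card => x; rewrite !inE.
- rewrite card_sig -(card_kept q0 (is_plane_dual pl) (frame_dual fr)).
  by apply: eq_card => x; rewrite !inE.
- by lia.
- by rewrite muln_gt0 expn_gt0; lia.
- exact: kept_card_pencil.
- exact: kept_card_line.
- exact: kept_hexagons.
Qed.
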